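(* For every integer $n\geq 1$, \[ \mathrm{Ht}(\mathrm{LCong}(\mathcal T_n)) = \sum_{r=1}^n \binom nr\, \mathrm{Ht}(\mathrm{Sub}(\mathcal S_r)). \]
   Context: The height $\mathrm{Ht}(P)$ of a poset $P$ is the supremum of the cardinalities (numbers of elements) of chains in $P$. $\mathcal T_n$ is the full transformation monoid: all maps $\{1,\dots,n\}\to\{1,\dots,n\}$, with maps written to the right of their arguments and composed from left to right, i.e. $x(\alpha\beta)=(x\alpha)\beta$. A left congruence of a semigroup $S$ is an equivalence relation $\sigma$ on $S$ such that $(x,y)\in\sigma$ implies $(ax,ay)\in\sigma$ for all $a,x,y\in S$; $\mathrm{LCong}(S)$ is the lattice of all left congruences of $S$ ordered by inclusion. $\mathcal S_r$ is the symmetric group of degree $r$, and $\mathrm{Sub}(G)$ is the lattice of subgroups of a group $G$ ordered by inclusion. *)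

(* Defs.v *)
From HB Require Import structures.
From mathcomp Require Import all_boot all_order all_fingroup.

Set Implicit Arguments.
Unset Strict Implicit.
Unset Printing Implicit Defensive.

Definition chain d (P : finPOrderType d) (C : {set P}) : bool :=
  [forall x in C, forall y in C, (x >=< y)%O].

(* In a finite poset the supremum of the cardinalities of chains is a
   maximum. *)
Definition height d (P : finPOrderType d) : nat :=
  \max_(C : {set P} | chain C) #|C|.

Fact inclusion_display : Order.disp_t.
Proof. exact: Order.Disp tt tt. Qed.

(* A finite semigroup is given by its carrier [S] and its associative operation
   [op]; a binary relation on [S] is given by its graph, so that the order of
   relations is inclusion of sets. *)
Definition left_congruence (S : finType) (op : SemiGroup.law S)
    (sigma : {set S * S}) : bool :=
  [&& [forall x, (x, x) \in sigma],
      [forall x, forall y, ((x, y) \in sigma) ==> ((y, x) \in sigma)],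
      [forall x, forall y, forall z,
         ((x, y) \in sigma) && ((y, z) \in sigma) ==> ((x, z) \in sigma)] &
      [forall a, forall x, forall y,
         ((x, y) \in sigma) ==> ((op a x, op a y) \in sigma)]].

Record LCong (S : finType) (op : SemiGroup.law S) := MkLCong {
  graph_of_lcong :> {set S * S};
  lcongP : left_congruence op graph_of_lcong
}.

Section LCongOrder.
Variables (S : finType) (op : SemiGroup.law S).

HB.instance Definition _ := [isSub for @graph_of_lcong S op].
HB.instance Definition _ := [Finite of LCong op by <:].

Definition lcong_le (sigma tau : LCong op) : bool :=
  graph_of_lcong sigma \subset graph_of_lcong tau.

Fact lcong_le_refl : reflexive lcong_le.
Proof. by move=> sigma; apply: subxx. Qed.

Fact lcong_le_anti : antisymmetric lcong_le.
Proof. by move=> sigma tau H; apply/val_inj/eqP; rewrite eqEsubset. Qed.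

Fact lcong_le_trans : transitive lcong_le.
Proof. by move=> tau sigma rho; apply: subset_trans. Qed.

HB.instance Definition _ := Order.Le_isPOrder.Build inclusion_display (LCong op)
  lcong_le_refl lcong_le_anti lcong_le_trans.
End LCongOrder.

Definition Subgroups (gT : finGroupType) : Type := {group gT}.

Section SubgroupsOrder.
Variable gT : finGroupType.

HB.instance Definition _ := Finite.on (Subgroups gT).

Definition subgroup_le (H K : Subgroups gT) : bool :=
  (H : {group gT}) \subset (K : {group gT}).

Fact subgroup_le_refl : reflexive subgroup_le.
Proof. by move=> H; apply: subxx. Qed.

Fact subgroup_le_anti : antisymmetric subgroup_le.
Proof. by move=> H K HK; apply/val_inj/eqP; rewrite eqEsubset. Qed.

Fact subgroup_le_trans : transitive subgroup_le.
Proof. by move=> K H L; apply: subset_trans. Qed.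

HB.instance Definition _ :=
  Order.Le_isPOrder.Build inclusion_display (Subgroups gT)
    subgroup_le_refl subgroup_le_anti subgroup_le_trans.
End SubgroupsOrder.

Definition transf (n : nat) := {ffun 'I_n -> 'I_n}.

Section Transformations.
Variable n : nat.

HB.instance Definition _ := Finite.on (transf n).

Definition transf_id : transf n := [ffun x => x].

(* Maps act on the right: x (f g) = (x f) g. *)
Definition transf_mul (f g : transf n) : transf n := [ffun x => g (f x)].

Fact transf_mulA : associative transf_mul.
Proof. by move=> f g h; apply/ffunP => x; rewrite !ffunE. Qed.

Fact transf_mul1f : left_id transf_id transf_mul.
Proof. by move=> f; apply/ffunP => x; rewrite !ffunE. Qed.

Fact transf_mulf1 : right_id transf_id transf_mul.
Proof. by move=> f; apply/ffunP => x; rewrite !ffunE. Qed.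

HB.instance Definition _ :=
  Monoid.isLaw.Build (transf n) transf_id transf_mul
    transf_mulA transf_mul1f transf_mulf1.
End Transformations.

(* Main.v *)
Require Import Defs.
From HB Require Import structures.
From mathcomp Require Import all_boot all_order all_fingroup.
From mathcomp Require Import zify.

(** Left multiplication by [c] replaces a map [a] by [c] followed by [a], so it
    can only shrink the image of [a].  Two maps with the same image [A] generate
    the same left ideal.  Hence a left congruence is governed, one nonempty
    set [A] at a time, by what it does to the maps with image [A], and each [A]
    contributes [height (Subgroups 'S_#|A|)] steps: there are ['C(n, r)] sets of
    size [r].

    Number the subsets of ['I_n] by a linear extension [setpos] of inclusion.  For
    a left congruence [s], call [A] reducible when [s] relates some map with image
    [A] to a map with an earlier image; then every map with image [A] is related
    to one with an earlier image.  Let [stab s A] be the group of the permutations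
    [g] of [A] such that [s] relates [a] to [a] followed by [g] for all maps [a]
    into [A].  If [A] is irreducible, two related maps with image [A] have the
    same kernel ([irreducible_ker]), so they differ by an element of [stab s A].
    Consequently, for [s <= t], equality follows once [s] and [t] have the same
    reducible sets and the same groups at the irreducible ones
    ([lcong_le_of_invariants]).

    Upper bound: give [A] the weight [height (Subgroups 'S_#|A|)] if it is
    reducible and the depth of [stab s A] in the subgroup lattice otherwise.  The
    total weight increases strictly with [s].  The first nonempty set is never
    reducible, so the total weight stays strictly below the sum of the heights.

    Lower bound: for a set [A] and a subgroup [H] of its symmetric group, identify
    all maps whose image precedes [A], and identify maps into [A] that differ by
    an element of [H].  This is a left congruence [collapse H]; it grows with [A],
    and with [H] when [A] is fixed.  Letting [H] run through a longest chain for
    each [A] other than the first, and adding the full relation, gives a chain of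
    the required size; the first set is a singleton, and the full relation
    accounts for its contribution [1]. *)

Set Implicit Arguments.
Unset Strict Implicit.
Unset Printing Implicit Defensive.

Import Order.TTheory.

(** * Heights of finite posets *)

Section Height.
Variables (d : Order.disp_t) (P : finPOrderType d).
Implicit Types (x y : P) (C : {set P}).

Lemma chainP C : reflect {in C &, forall x y, (x >=< y)%O} (chain C).
Proof.
apply: (iffP forall_inP) => [H x y xC yC|H x xC].
  by move/forall_inP: (H _ xC); apply.
by apply/forall_inP => y yC; apply: H.
Qed.

Lemma leq_card_height C : chain C -> #|C| <= height P.
Proof. by move=> chC; exact: leq_bigmax_cond. Qed.

Lemma longest_chain : {C : {set P} | chain C & #|C| = height P}.
Proof.
have ch0 : 0 < #|[pred C : {set P} | chain C]|.
  apply/card_gt0P; exists set0; rewrite inE.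
  by apply/chainP => x y; rewrite inE.
by have [C chC eqC] := eq_bigmax_cond (fun C : {set P} => #|C|) ch0; exists C.
Qed.

Lemma height_le_of_homo (f : P -> nat) N :
    {homo f : x y / (x < y)%O >-> x < y} -> (forall x, f x < N) ->
  height P <= N.
Proof.
move=> fmono fN; apply/bigmax_leqP => C /chainP chC.
pose g x : 'I_N := Ordinal (fN x).
have g_inj : {in C &, injective g}.
  move=> x y xC yC [eqf]; have := chC _ _ xC yC.
  by case: comparableP => // [/fmono|/fmono]; rewrite eqf ltnn.
rewrite -(card_in_imset g_inj) -[leqRHS]card_ord; exact: max_card.
Qed.

(** A substitute for a rank function in a poset that need not be graded. *)
Definition depth x := \max_(C | chain C && [forall y in C, (y < x)%O]) #|C|.

Lemma chain_below_add x C : chain C -> {in C, forall y, (y < x)%O} ->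
  chain (x |: C) /\ #|x |: C| = #|C|.+1.
Proof.
move=> /chainP chC Cx; split; last first.
  by rewrite cardsU1; case: (boolP (x \in C)) => // /Cx; rewrite ltxx.
apply/chainP => y z /setU1P[->|yC] /setU1P[->|zC]; first exact: comparablexx.
- by rewrite comparable_sym; exact/lt_comparable/Cx.
- exact/lt_comparable/Cx.
- exact: chC.
Qed.

Lemma depth_attained x :
  {C : {set P} | [/\ chain C, {in C, forall y, (y < x)%O} & #|C| = depth x]}.
Proof.
have ne : 0 < #|[pred C : {set P} | chain C && [forall y in C, (y < x)%O]]|.
  apply/card_gt0P; exists set0; rewrite inE; apply/andP; split.
    by apply/chainP => y z; rewrite inE.
  by apply/forall_inP => y; rewrite inE.
have [C /andP[chC /forall_inP Cx] eqC] :=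
  eq_bigmax_cond (fun C : {set P} => #|C|) ne.
by exists C.
Qed.

Lemma depth_lt_height x : depth x < height P.
Proof.
have [C [chC Cx <-]] := depth_attained x.
by have [chxC <-] := chain_below_add chC Cx; exact: leq_card_height.
Qed.

Lemma depth_homo : {homo depth : x y / (x < y)%O >-> x < y}.
Proof.
move=> x y ltxy; have [C [chC Cx <-]] := depth_attained x.
have [chxC <-] := chain_below_add chC Cx.
apply: leq_bigmax_cond; rewrite chxC; apply/forall_inP => z /setU1P[-> //|zC].
exact: lt_trans (Cx z zC) ltxy.
Qed.

End Height.

(** * Images of transformations, and maps given by labels *)

Section Images.
Variable n : nat.
Implicit Types (a b c : transf n) (A B : {set 'I_n}).

Definition img a : {set 'I_n} := [set a x | x : 'I_n].

Lemma mem_img a x : a x \in img a.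
Proof. exact: imset_f. Qed.

Lemma img_mulS a b : img (transf_mul a b) \subset img b.
Proof. by apply/subsetP => _ /imsetP[x _ ->]; rewrite ffunE mem_img. Qed.

(** Inclusion of images is exactly the order of principal left ideals, so a pair
    related by a left congruence can be transported to any map with a smaller or
    equal image. *)
Lemma img_subP a b :
  reflect (exists c, a = transf_mul c b) (img a \subset img b).
Proof.
apply: (iffP idP) => [sab|[c ->]]; last exact: img_mulS.
have pre x : {y | a x = b y}.
  have /imsetP/sig2_eqW[y _ ->] : a x \in img b by exact/(subsetP sab)/mem_img.
  by exists y.
exists [ffun x => sval (pre x)]; apply/ffunP => x; rewrite !ffunE.
exact: svalP (pre x).
Qed.

Lemma img_neq0 a : 0 < n -> img a != set0.
Proof. by move=> n0; apply/set0Pn; exists (a (Ordinal n0)); exact: mem_img. Qed.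

(** A numbering of the subsets by size, ties being broken by the enumeration of
    [{set 'I_n}]: the enumeration makes it injective, the size a linear
    extension of inclusion. *)
Definition setpos A := #|A| * #|{set 'I_n}| + enum_rank A.

Lemma setpos_inj : injective setpos.
Proof.
move=> A B /(congr1 (modn^~ #|{set 'I_n}|)).
by rewrite !modnMDl !modn_small ?ltn_ord // => /ord_inj/enum_rank_inj.
Qed.

Lemma setpos_proper A B : A \proper B -> setpos A < setpos B.
Proof.
move=> /proper_card ltAB; apply: (@leq_trans (#|A|.+1 * #|{set 'I_n}|)).
  by rewrite mulSn addnC /setpos ltn_add2l ltn_ord.
by apply: leq_trans (leq_addr _ _); rewrite leq_mul2r ltAB orbT.
Qed.

Lemma setpos_sub A B : A \subset B -> setpos A <= setpos B.
Proof.
by rewrite subEproper => /predU1P[-> //|/setpos_proper/ltnW].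
Qed.

Lemma first_set_singleton : 0 < n -> exists x : 'I_n,
  forall A, A != set0 -> setpos [set x] <= setpos A.
Proof.
move=> n0.
case: (@arg_minnP _ (Ordinal n0) predT (fun x => setpos [set x])) => // x _ xmin.
exists x => A /set0Pn[y yA]; apply: leq_trans (xmin y isT) _.
by rewrite setpos_sub // sub1set.
Qed.

(** Labelling the elements of [A] by ['I_#|A|] turns maps into [A] into maps to
    ['I_#|A|], on which ['S_#|A|] itself acts; this avoids transporting subgroups
    between ['S_#|A|] and the symmetric group of [A]. *)
Definition of_labels A (u : 'I_n -> 'I_#|A|) : transf n := [ffun x => enum_val (u x)].

Lemma img_of_labelsS A (u : 'I_n -> 'I_#|A|) : img (of_labels u) \subset A.
Proof. by apply/subsetP => _ /imsetP[x _ ->]; rewrite ffunE enum_valP. Qed.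

Lemma of_labels_inj A (u v : 'I_n -> 'I_#|A|) : of_labels u = of_labels v -> u =1 v.
Proof. by move=> /ffunP e x; have := e x; rewrite !ffunE => /enum_val_inj. Qed.

Lemma eq_of_labels A (u v : 'I_n -> 'I_#|A|) : u =1 v -> of_labels u = of_labels v.
Proof. by move=> e; apply/ffunP => x; rewrite !ffunE e. Qed.

Lemma mul_of_labels A a (u : 'I_n -> 'I_#|A|) :
  transf_mul a (of_labels u) = of_labels (u \o a).
Proof. by apply/ffunP => x; rewrite !ffunE. Qed.

Lemma of_labelsP A a : A != set0 -> img a \subset A ->
  exists u : 'I_n -> 'I_#|A|, a = of_labels u.
Proof.
move=> /set0Pn[x0 x0A] sA; exists (fun x => enum_rank_in x0A (a x)).
apply/ffunP => x; rewrite ffunE enum_rankK_in //.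
exact/(subsetP sA)/mem_img.
Qed.

Lemma img_of_labels_onto A (u : 'I_n -> 'I_#|A|) :
  img (of_labels u) = A -> forall i, exists x, u x = i.
Proof.
move=> e i; have : enum_val i \in img (of_labels u) by rewrite e enum_valP.
by case/imsetP=> x _; rewrite ffunE => /enum_val_inj->; exists x.
Qed.

Lemma card_img_perm A (u : 'I_n -> 'I_#|A|) (g : 'S_#|A|) :
  #|img (of_labels (g \o u))| = #|img (of_labels u)|.
Proof.
have E v : #|img (@of_labels A v)| = #|[set v x | x : 'I_n]|.
  rewrite -(card_imset _ (@enum_val_inj _ (mem A))) -imset_comp.
  by apply: eq_card; apply/setP/eq_imset => x; rewrite /= ffunE.
by rewrite !E (imset_comp g u) card_imset //; exact: perm_inj.
Qed.

(** An image contained in [A] precedes [A] exactly when it is smaller, and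
    permuting the labels does not change its size. *)
Lemma setpos_of_labels_perm A (u : 'I_n -> 'I_#|A|) (g : 'S_#|A|) :
  (setpos (img (of_labels (g \o u))) < setpos A) =
  (setpos (img (of_labels u)) < setpos A).
Proof.
have E v : (setpos (img (@of_labels A v)) < setpos A) =
           (#|img (@of_labels A v)| < #|A|).
  have := img_of_labelsS v; rewrite subEproper => /predU1P[->|pv].
    by rewrite !ltnn.
  by rewrite setpos_proper // proper_card.
by rewrite !E card_img_perm.
Qed.

Lemma img_onto A : A != set0 -> exists a, img a = A.
Proof.
move=> /set0Pn[x0 x0A]; exists [ffun x => if x \in A then x else x0].
apply/setP => y; apply/imsetP/idP => [[x _ ->]|yA].
  by rewrite ffunE; case: ifP.
by exists y => //; rewrite ffunE yA.
Qed.

End Images.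

(** * Reducible sets, stabilizers, and the upper bound *)

Section UpperBound.
Variables (n : nat) (n_gt0 : 0 < n).
Local Notation lcong := (LCong (@transf_mul n)).
Implicit Types (s t : lcong) (a b c : transf n) (A B : {set 'I_n}).

Lemma lcong_refl s a : (a, a) \in (s : {set _}).
Proof. by have /and4P[/forallP + _ _ _] := lcongP s; apply. Qed.

Lemma lcong_sym s a b : (a, b) \in (s : {set _}) -> (b, a) \in (s : {set _}).
Proof.
by have /and4P[_ /forallP/(_ a)/forallP/(_ b)/implyP + _ _] := lcongP s; apply.
Qed.

Lemma lcong_trans s b a c :
  (a, b) \in (s : {set _}) -> (b, c) \in (s : {set _}) ->
  (a, c) \in (s : {set _}).
Proof.
have /and4P[_ _ /forallP/(_ a)/forallP/(_ b)/forallP/(_ c)/implyP tr _] :=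
  lcongP s.
by move=> ab bc; apply: tr; rewrite ab.
Qed.

Lemma lcong_mul s c a b : (a, b) \in (s : {set _}) ->
  (transf_mul c a, transf_mul c b) \in (s : {set _}).
Proof.
by have /and4P[_ _ _ /forallP/(_ c)/forallP/(_ a)/forallP/(_ b)/implyP] :=
  lcongP s.
Qed.

Definition reducible s A :=
  [exists a, exists b,
    [&& img a == A, (a, b) \in (s : {set _}) & setpos (img b) < setpos A]].

(** One reducible map with a given image suffices: the others are its left
    multiples, and multiplying moves images only to earlier positions. *)
Lemma exists_reduct s a : reducible s (img a) ->
  exists2 b, (a, b) \in (s : {set _}) & setpos (img b) < setpos (img a).
Proof.
case/existsP=> a' /existsP[b /and3P[/eqP ea' sab ltb]].
have /img_subP[c ea] : img a \subset img a' by rewrite ea'.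
exists (transf_mul c b); first by rewrite ea; exact: lcong_mul.
exact: leq_ltn_trans (setpos_sub (img_mulS c b)) ltb.
Qed.

(** If [a] identified two points [x], [y] that [b] separates, choose a section of
    [b] through [x] and [y]; multiplying by [b] followed by that section fixes [b]
    and shrinks the image of [a], which would make the common image reducible. *)
Lemma irreducible_ker s a b : (a, b) \in (s : {set _}) -> img a = img b ->
  ~~ reducible s (img a) -> forall x y, a x = a y -> b x = b y.
Proof.
move=> sab eab irr x y axy; apply/eqP; apply: contraNT irr => bxy.
have pre i : {z | i \in img b -> b z = i}.
  case: (boolP (i \in img b)) => [/imsetP/sig2_eqW[z _ ->]|_]; first by exists z.
  by exists x.
(* [r] is the section of [b] through [x] and [y]. *)
pose r i := if i == b x then x else if i == b y then y else sval (pre i).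
pose c : transf n := [ffun z => r (b z)].
have brK i : i \in img b -> b (r i) = i.
  by rewrite /r; case: eqP => [-> //|_]; case: eqP => [-> //|_]; exact: (svalP (pre i)).
have cb : transf_mul c b = b.
  by apply/ffunP => z; rewrite !ffunE brK // mem_img.
have rx : r (b x) = x by rewrite /r eqxx.
have ry : r (b y) = y by rewrite /r eq_sym (negPf bxy) eqxx.
have ica : img (transf_mul c a) = [set a (r i) | i in img b].
  by rewrite /img -imset_comp; apply: eq_imset => z; rewrite /= !ffunE.
apply/existsP; exists b; apply/existsP; exists (transf_mul c a).
rewrite eab eqxx -{1}cb lcong_sym ?lcong_mul //=.
apply: setpos_proper; rewrite properEneq -eab img_mulS andbT.
apply: contra bxy => /eqP eca.
have /imset_injP inj : #|[set a (r i) | i in img b]| == #|img b|.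
  by rewrite -ica eca eab.
by rewrite (inj (b x) (b y)) ?mem_img // rx ry.
Qed.

Definition stab s A : {set 'S_#|A|} :=
  [set g : 'S_#|A| | [forall u : {ffun 'I_n -> 'I_#|A|},
     (of_labels u, of_labels (g \o u)) \in (s : {set _})]].

Lemma stabP s A (g : 'S_#|A|) :
  reflect (forall u : 'I_n -> 'I_#|A|,
             (of_labels u, of_labels (g \o u)) \in (s : {set _}))
          (g \in stab s A).
Proof.
rewrite inE; apply: (iffP forallP) => [H u|H u]; last exact: H.
have uE : finfun u =1 u by exact: ffunE.
have guE : g \o finfun u =1 g \o u by move=> x; rewrite /= uE.
by rewrite -(eq_of_labels uE) -(eq_of_labels guE); exact: H.
Qed.

Lemma stab_group_set s A : group_set (stab s A).
Proof.
apply/group_setP; split=> [|g h /stabP sg /stabP sh]; apply/stabP => u.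
  have e1 : (1%g : 'S_#|A|) \o u =1 u by move=> x; rewrite /= perm1.
  by rewrite (eq_of_labels e1) lcong_refl.
have egh : (g * h)%g \o u =1 h \o (g \o u) by move=> x; rewrite /= permM.
by rewrite (eq_of_labels egh); exact: lcong_trans (sg u) (sh _).
Qed.

Definition stab_group s A : Subgroups 'S_#|A| := Group (stab_group_set s A).

(** Equal kernels yield a permutation [g] of the labels carrying [a] to [b].  Every
    map into the image of [a] is a left multiple of [a], so the single related
    pair puts [g] into the stabilizer. *)
Lemma stab_of_related s a b : (a, b) \in (s : {set _}) -> img a = img b ->
  ~~ reducible s (img a) ->
  exists u, exists2 g, g \in stab s (img a) &
    a = of_labels u /\ b = of_labels (g \o u).
Proof.
move=> sab eab irr.
have [u ea] := of_labelsP (img_neq0 a n_gt0) (subxx _).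
have [v eb] : exists v : 'I_n -> 'I_#|img a|, b = of_labels v.
  by apply: of_labelsP; rewrite ?eab // img_neq0.
have uonto : forall i, exists x, u x = i by apply: img_of_labels_onto; rewrite -ea.
have uK i : {x | u x == i}.
  by apply: sigW; have [x <-] := uonto i; exists x.
have uvE x y : (u x = u y) <-> (v x = v y).
  have ax z : a z = enum_val (u z) by rewrite {1}ea ffunE.
  have bx z : b z = enum_val (v z) by rewrite {1}eb ffunE.
  have irr' : ~~ reducible s (img b) by rewrite -eab.
  split=> e; apply/(@enum_val_inj _ (mem (img a))).
    by rewrite -!bx; apply: (irreducible_ker sab) => //; rewrite !ax e.
  rewrite -!ax; apply: (irreducible_ker (lcong_sym sab)) => //.
  by rewrite !bx e.
pose g0 i := v (sval (uK i)).
have g0_inj : injective g0.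
  by move=> i j /uvE; rewrite (eqP (svalP (uK i))) (eqP (svalP (uK j))).
have gu x : perm g0_inj (u x) = v x.
  by rewrite permE; apply/uvE; rewrite (eqP (svalP (uK _))).
have egu : b = of_labels (perm g0_inj \o u).
  by rewrite eb; apply: eq_of_labels => x; rewrite /= gu.
exists u, (perm g0_inj) => //; apply/stabP => w.
pose c : transf n := [ffun x => sval (uK (w x))].
have uc x : u (c x) = w x by rewrite ffunE (eqP (svalP (uK _))).
have := lcong_mul c sab; rewrite {1}ea egu !mul_of_labels.
have guc : (perm g0_inj \o u) \o c =1 perm g0_inj \o w by move=> x; rewrite /= uc.
by rewrite (eq_of_labels uc) (eq_of_labels guc).
Qed.

(** By induction on the positions of the two images: a map with reducible image
    is replaced by an earlier one related to it already in [s].  When both images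
    are irreducible, neither can precede the other, so they coincide and
    the pair comes from the stabilizer. *)
Lemma lcong_le_of_invariants s t : (s <= t)%O ->
    (forall A, A != set0 -> reducible t A -> reducible s A) ->
    (forall A, A != set0 -> ~~ reducible t A -> stab t A \subset stab s A) ->
  (t <= s)%O.
Proof.
move=> /subsetP st red_ts stab_ts.
suff main m a b : setpos (img a) + setpos (img b) < m ->
    (a, b) \in (t : {set _}) -> (a, b) \in (s : {set _}).
  by apply/subsetP => -[a b]; exact: main.
elim: m a b => // m IHm a b ltm tab.
wlog irr_a : a b ltm tab / ~~ reducible t (img a).
  move=> wl; have [ra|/wl] := boolP (reducible t (img a)); last exact.
  have [a' saa' lta'] := exists_reduct (red_ts _ (img_neq0 a n_gt0) ra).
  apply: (lcong_trans saa'); apply: IHm; first by lia.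
  exact: lcong_trans (lcong_sym (st _ saa')) tab.
have [rb|irr_b] := boolP (reducible t (img b)).
  have [b' sbb' ltb'] := exists_reduct (red_ts _ (img_neq0 b n_gt0) rb).
  apply: lcong_trans (lcong_sym sbb'); apply: IHm; first by lia.
  exact: lcong_trans tab (st _ sbb').
have le c d : (c, d) \in (t : {set _}) -> ~~ reducible t (img c) ->
    setpos (img c) <= setpos (img d).
  move=> tcd; rewrite leqNgt; apply: contra => lt.
  by apply/existsP; exists c; apply/existsP; exists d; rewrite eqxx tcd.
have eab : img a = img b.
  by apply/setpos_inj/eqP; rewrite eqn_leq !le // lcong_sym.
have [u [g gt [ea eb]]] := stab_of_related tab eab irr_a.
have /stabP/(_ u) := subsetP (stab_ts _ (img_neq0 a n_gt0) irr_a) _ gt.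
by rewrite -ea -eb.
Qed.

(** [depth] stays below the height, so becoming reducible is one more strict step
    above the whole subgroup lattice. *)
Definition weight s A :=
  if reducible s A then height (Subgroups 'S_#|A|) else depth (stab_group s A).

Lemma reducible_mono s t A : (s <= t)%O -> reducible s A -> reducible t A.
Proof.
move=> /subsetP st /existsP[a /existsP[b /and3P[ea sab lt]]].
by apply/existsP; exists a; apply/existsP; exists b; rewrite ea st.
Qed.

Lemma stab_mono s t A : (s <= t)%O -> (stab_group s A <= stab_group t A)%O.
Proof.
move=> /subsetP st; apply/subsetP => g /stabP sg; apply/stabP => u.
exact/st/sg.
Qed.

(** The equality case is phrased as the agreement of invariants, which is what
    [lcong_le_of_invariants] consumes once the sums over all [A] are equal. *)
Lemma weight_leif s t A : (s <= t)%O ->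
  weight s A <= weight t A ?= iff
    (reducible t A ==> reducible s A) &&
    (~~ reducible t A ==> (stab t A \subset stab s A)).
Proof.
move=> st; have := @reducible_mono s t A st; rewrite /weight.
case: (reducible s A) => [->//|_]; first exact/leqif_refl.
case: (reducible t A) => /=.
  by split; rewrite ?(ltn_eqF (depth_lt_height _)) // ltnW // depth_lt_height.
have := stab_mono A st; rewrite le_eqVlt => /predU1P[e|lt].
  by rewrite e; split; rewrite // eqxx; move: e => /(congr1 val)/= ->; rewrite subxx.
split; first exact/ltnW/depth_homo.
rewrite (ltn_eqF (depth_homo lt)); apply/esym/negbTE.
by move: lt; rewrite lt_leAnge => /andP[].
Qed.

Lemma height_lcong_upper : height lcong <=
  \sum_(A : {set 'I_n} | A != set0) height (Subgroups 'S_#|A|).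
Proof.
apply: (@height_le_of_homo _ _
         (fun s => \sum_(A : {set 'I_n} | A != set0) weight s A)).
  move=> s t lt_st; have le_st := ltW lt_st.
  have [leS eqS] := leqif_sum (fun A (_ : A != set0) => weight_leif A le_st).
  rewrite ltn_neqAle leS eqS andbT; apply/negP => /forall_inP inv.
  have := lt_geF lt_st; rewrite (@lcong_le_of_invariants s t) // => A A0.
    by move/inv/andP: A0 => [/implyP].
  by move/inv/andP: A0 => [_ /implyP].
move=> s; have [x xmin] := first_set_singleton n_gt0.
have x0 : [set x] != set0 by apply/set0Pn; exists x; rewrite inE.
rewrite (bigD1 [set x] x0) [ltnRHS](bigD1 [set x] x0) -addSn leq_add //.
  rewrite /weight ifN ?depth_lt_height //; apply/existsP => -[a /existsP[b]].
  by rewrite ltnNge xmin ?andbF // img_neq0.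
apply: leq_sum => A _; rewrite /weight; case: ifP => // _.
exact/ltnW/depth_lt_height.
Qed.

End UpperBound.

(** * A long chain of left congruences *)

Section LowerBound.
Variables (n : nat) (n_gt0 : 0 < n).
Local Notation lcong := (LCong (@transf_mul n)).
Implicit Types (a b c : transf n) (A B : {set 'I_n}).

Section Collapse.
Variables (A : {set 'I_n}) (H : {group 'S_#|A|}).

(** The labels [u] need not be onto: for other [u] both maps have an image before
    [A], and the second disjunct covers the pair. *)
Definition collapse_graph : {set transf n * transf n} :=
  [set p | [|| p.1 == p.2,
    (setpos (img p.1) < setpos A) && (setpos (img p.2) < setpos A) |
    [exists u : {ffun 'I_n -> 'I_#|A|}, exists g in H,
      (p.1 == of_labels u) && (p.2 == of_labels (g \o u))]]].

Lemma collapse_graphP a b :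
  reflect [\/ a = b, (setpos (img a) < setpos A) && (setpos (img b) < setpos A)
    | exists u : 'I_n -> 'I_#|A|, exists2 g, g \in H &
        a = of_labels u /\ b = of_labels (g \o u)]
    ((a, b) \in collapse_graph).
Proof.
rewrite inE /=; apply: (iffP or3P) => -[eab|lt|o].
- by constructor 1; apply/eqP.
- by constructor 2.
- constructor 3; case/existsP: o => u /exists_inP[g gH /andP[/eqP-> /eqP->]].
  by exists u, g.
- by constructor 1; apply/eqP.
- by constructor 2.
constructor 3; case: o => u [g gH [-> ->]].
have uE : u =1 finfun u by move=> x; apply/esym/(ffunE u).
have guE : g \o u =1 g \o finfun u by move=> x; rewrite /= -uE.
apply/existsP; exists (finfun u); apply/exists_inP; exists g => //.
by rewrite (eq_of_labels uE) (eq_of_labels guE) !eqxx.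
Qed.

Lemma collapse_graph_lcong : left_congruence (@transf_mul n) collapse_graph.
Proof.
apply/and4P; split.
- by apply/forallP => a; apply/collapse_graphP; constructor 1.
- apply/forallP=> a; apply/forallP=> b; apply/implyP=> /collapse_graphP[->|lt|].
  + by apply/collapse_graphP; constructor 1.
  + by apply/collapse_graphP; constructor 2; rewrite andbC.
  move=> [u [g gH [-> ->]]]; apply/collapse_graphP; constructor 3.
  exists (g \o u), (g^-1)%g; rewrite ?groupV //; split=> //.
  by apply: eq_of_labels => x; rewrite /= permK.
- apply/forallP=> a; apply/forallP=> b; apply/forallP=> c.
  apply/implyP=> /andP[/collapse_graphP ab /collapse_graphP bc].
  apply/collapse_graphP.
  case: ab bc => [->//|/andP[lta ltb]|[u [g gH [-> eb]]]].
    move=> [<-|/andP[_ ltc]|[v [h hH [eb ->]]]]; constructor 2.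
    + by rewrite lta.
    + by rewrite lta.
    by rewrite lta setpos_of_labels_perm -eb.
  move=> [<-|/andP[ltb ltc]|[v [h hH [eb' ->]]]].
  + by constructor 3; exists u, g.
  + by constructor 2; rewrite ltc -(setpos_of_labels_perm u g) -eb ltb.
  constructor 3; exists u, (g * h)%g; rewrite ?groupM //; split=> //.
  have gu := of_labels_inj (etrans (esym eb) eb').
  by apply: eq_of_labels => x; rewrite /= permM -gu.
apply/forallP=> c; apply/forallP=> a; apply/forallP=> b.
apply/implyP=> /collapse_graphP ab; apply/collapse_graphP.
have lt d : setpos (img d) < setpos A -> setpos (img (transf_mul c d)) < setpos A.
  exact/leq_ltn_trans/setpos_sub/img_mulS.
case: ab => [->|/andP[lta ltb]|[u [g gH [-> ->]]]].
- by constructor 1.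
- by constructor 2; rewrite !lt.
by constructor 3; exists (u \o c), g => //; split; exact: mul_of_labels.
Qed.

Definition collapse : lcong := MkLCong collapse_graph_lcong.

(** Maps with image [A] stay separate from maps with other images; this tells the
    congruences of the chain apart for different [A]. *)
Lemma collapse_img a b : (a, b) \in collapse_graph -> img a = A -> img b = A.
Proof.
move=> /collapse_graphP[->->//|/andP[+ _] ea|[u [g gH [-> ->]]] eu].
  by rewrite ea ltnn.
by apply/eqP; rewrite eqEcard img_of_labelsS card_img_perm eu leqnn.
Qed.

End Collapse.

Lemma collapse_below A (H : {group 'S_#|A|}) B (K : {group 'S_#|B|}) :
  setpos A < setpos B -> (collapse H <= collapse K)%O.
Proof.
move=> ltAB; apply/subsetP => -[a b] /collapse_graphP ab; apply/collapse_graphP.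
have le u : setpos (img (@of_labels _ A u)) < setpos B.
  exact: leq_ltn_trans (setpos_sub (img_of_labelsS u)) ltAB.
case: ab => [->|/andP[lta ltb]|[u [g gH [-> ->]]]]; first by constructor 1.
  by constructor 2; rewrite !(ltn_trans _ ltAB).
by constructor 2; rewrite !le.
Qed.

Lemma collapse_mono A (H K : {group 'S_#|A|}) :
  H \subset K -> (collapse H <= collapse K)%O.
Proof.
move=> sHK; apply/subsetP => -[a b] /collapse_graphP ab; apply/collapse_graphP.
case: ab => [->|lt|[u [g gH e]]]; first by constructor 1.
  by constructor 2.
by constructor 3; exists u, g; rewrite ?(subsetP sHK).
Qed.

Lemma collapse_inj A : A != set0 -> injective (@collapse A).
Proof.
move=> A0; suff sub (H K : {group 'S_#|A|}) : collapse H = collapse K -> H \subset K.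
  by move=> H K e; apply/val_inj/eqP; rewrite eqEsubset !sub.
move=> /(congr1 (@graph_of_lcong _ _))/= e; apply/subsetP => g gH.
have [a ea] := img_onto A0.
have [u eu] : exists u : 'I_n -> 'I_#|A|, a = of_labels u.
  by apply: of_labelsP; rewrite ?ea.
have uonto : forall i, exists x, u x = i by apply: img_of_labels_onto; rewrite -eu.
have : (of_labels u, of_labels (g \o u)) \in collapse_graph K.
  by rewrite -e; apply/collapse_graphP; constructor 3; exists u, g.
move=> /collapse_graphP[/of_labels_inj eg|/andP[+ _]|
  [v [h hK [/of_labels_inj ev /of_labels_inj eg]]]].
- suff -> : g = 1%g by exact: group1.
  by apply/permP => i; have [x <-] := uonto i; rewrite perm1 {2}eg.
- by rewrite -eu ea ltnn.
suff -> : g = h by [].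
by apply/permP => i; have [x <-] := uonto i; rewrite {2}ev; exact: eg.
Qed.

Definition all_related : {set transf n * transf n} := setT.

Lemma all_related_lcong : left_congruence (@transf_mul n) all_related.
Proof.
apply/and4P; split; do !(apply/forallP => ?); rewrite ?inE ?implybT //.
Qed.

Definition full_lcong : lcong := MkLCong all_related_lcong.

Lemma collapse_neq_of_related A (H : {group 'S_#|A|}) B (s : lcong) :
    A != set0 -> B != set0 -> A != B ->
    (forall a b, img a = A -> img b = B -> (a, b) \in (s : {set _})) ->
  collapse H != s.
Proof.
move=> A0 B0 nAB sab; have [[a ea] [b eb]] := (img_onto A0, img_onto B0).
apply: contra nAB => /eqP eHs; have := sab _ _ ea eb.
by rewrite -eHs => /collapse_img; rewrite ea eb => ->.
Qed.

(** The chain described above.  A congruence [collapse H] at the first set would be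
    the equality relation, which already occurs at the second set for the trivial
    group (for [n > 1]); therefore the first set is left out and replaced by the
    full relation. *)
Lemma height_lcong_lower :
  \sum_(A : {set 'I_n} | A != set0) height (Subgroups 'S_#|A|) <= height lcong.
Proof.
have [x xmin] := first_set_singleton n_gt0.
have x0 : [set x] != set0 by apply/set0Pn; exists x; rewrite inE.
have x_lt A : A != set0 -> A != [set x] -> setpos [set x] < setpos A.
  move=> A0 nA; rewrite ltn_neqAle xmin // andbT.
  by apply: contra nA => /eqP/setpos_inj->.
have one : height (Subgroups 'S_#|[set x]|) <= 1.
  apply: (@height_le_of_homo _ _ (fun=> 0)) => // H K /lt_eqF/eqP[].
  have triv (L : Subgroups 'S_#|[set x]|) : (L : {set _}) = 1%g.
    apply/eqP; rewrite eqEsubset sub1G andbT; apply/subsetP => g _.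
    have sub1 (i j : 'I_#|[set x]|) : i = j.
      apply: (@enum_val_inj _ (mem [set x])).
      by rewrite (set1P (enum_valP i)) (set1P (enum_valP j)).
    by rewrite inE; apply/eqP/permP => i; exact: sub1.
  by apply/val_inj; rewrite /= !triv.
pose M A := s2val (longest_chain (Subgroups 'S_#|A|)).
have Mch A : chain (M A) := s2valP (longest_chain (Subgroups 'S_#|A|)).
have cardM A : #|M A| = height (Subgroups 'S_#|A|) :=
  s2valP' (longest_chain (Subgroups 'S_#|A|)).
pose F A := if (A != set0) && (A != [set x])
            then [set collapse H | H : Subgroups _ in M A] else set0.
have FP A s : s \in F A -> [/\ A != set0, A != [set x]
    & exists2 H : Subgroups _, H \in M A & s = collapse H].
  rewrite /F; case: ifP => [/andP[A0 nA] /imsetP[H HM ->]|]; last by rewrite inE.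
  by split=> //; exists H.
pose D := full_lcong |: \bigcup_A F A.
have chD : chain D.
  apply/chainP => s t; rewrite !inE.
  have top r : (r <= full_lcong)%O by exact: subsetT.
  move=> /predU1P[-> _|]; first by rewrite comparable_sym; exact/le_comparable/top.
  move=> sF /predU1P[->|tF]; first exact/le_comparable/top.
  have /bigcupP[A _ /FP[A0 _ [H HM ->]]] := sF.
  have /bigcupP[B _ /FP[B0 _ [K KM ->]]] := tF.
  have [ltAB|ltBA|/setpos_inj eAB] := ltngtP (setpos A) (setpos B).
  - exact/le_comparable/collapse_below.
  - by rewrite comparable_sym; exact/le_comparable/collapse_below.
  case: B / eAB K KM {B0 tF} => K KM.
  have /orP[HK|KH] := chainP _ (Mch A) _ _ HM KM.
    exact/le_comparable/collapse_mono.
  by rewrite comparable_sym; exact/le_comparable/collapse_mono.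
apply: leq_trans (leq_card_height chD).
rewrite (bigD1 [set x] x0) /= /D cardsU1.
have -> : full_lcong \notin \bigcup_A F A.
  apply/bigcupP => -[A _ /FP[A0 nA [H _ e]]].
  have /eqP[] : collapse H != full_lcong.
    by apply: (collapse_neq_of_related H A0 x0 nA) => a b _ _; rewrite inE.
  by rewrite e.
rewrite leq_add // -sum1_card.
rewrite (partition_disjoint_bigcup _ (fun=> 1)) => [|A B nAB]; last first.
  rewrite -setI_eq0; apply/eqP/setP => s; rewrite !inE; apply/negP => /andP[].
  move=> /FP[A0 nA [H _ ->]] /FP[B0 nB [K _ eHK]].
  wlog ltAB : A B nAB H K A0 nA B0 nB eHK / setpos A < setpos B.
    move=> wl; have [lt|lt|/setpos_inj eAB] := ltngtP (setpos A) (setpos B).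
    - exact: (wl A B nAB H K).
    - by apply: (wl B A _ K H) => //; rewrite eq_sym.
    by rewrite eAB eqxx in nAB.
  have /eqP[] : collapse H != collapse K; last by [].
  apply: (collapse_neq_of_related H A0 x0 nA) => a b ea eb.
  apply/collapse_graphP; constructor 2.
  by rewrite ea eb ltAB x_lt.
rewrite big_mkcond /=; apply: leq_sum => A _; rewrite sum1_card /F.
case: ifP => // /andP[A0 _].
by rewrite card_imset ?cardM //; exact: collapse_inj.
Qed.

End LowerBound.

(** * The height of the lattice of left congruences *)

Lemma sum_card_draws (n : nat) (F : nat -> nat) :
  \sum_(A : {set 'I_n} | A != set0) F #|A| = \sum_(1 <= r < n.+1) 'C(n, r) * F r.
Proof.
have cardn (A : {set 'I_n}) : #|A| < n.+1.
  by rewrite ltnS -[leqRHS]card_ord max_card.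
rewrite big_add1 /= big_mkord.
rewrite (partition_big (fun A : {set 'I_n} => Ordinal (cardn A))
                       (fun i => i != ord0)) /=; last first.
  by move=> A; rewrite -cards_eq0.
rewrite big_mkcond big_ord_recl /= add0n; apply: eq_bigr => i _.
rewrite (eq_bigr (fun=> F i.+1)) => [|A /andP[_ /eqP/(congr1 val)/= -> //]].
rewrite sum_nat_const; congr (_ * _).
have := card_draws 'I_n i.+1; rewrite card_ord => <-.
apply: eq_card => A; rewrite inE [LHS]unfold_in -cards_eq0 -val_eqE /= /bump /= add1n.
by case: eqP => [->|].
Qed.

Theorem theorem1p3 (n : nat) (hn : 1 <= n) :
  height (LCong (@transf_mul n)) =
    \sum_(1 <= r < n.+1) 'C(n, r) * height (Subgroups 'S_r).
Proof.
rewrite -(sum_card_draws n (fun r => height (Subgroups 'S_r))).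
by apply/eqP; rewrite eqn_leq height_lcong_upper // height_lcong_lower.
Qed.
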